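(* Let $a<b$ be real numbers. Let $f:[a,b]\to\mathbb{R}$ be continuous with $0<\inf_{t\in[a,b]}f(t)\le\sup_{t\in[a,b]}f(t)<\infty$, and let $F(t)=\int_a^t f(x)\,dx$ for $t\in[a,b]$. Let $L:[a,b]\to\mathbb{R}$ be non-decreasing and bounded. For each $n$, let $B_n$ be a process on $[L(a),L(b)]$ that is either Brownian motion or Brownian bridge, and let $F_n$ be a cadlag step estimator of $F$ on $[a,b]$ (a random cadlag step function) such that $$\sup_{t\in[a,b]}|F_n(t)-F(t)-n^{-1/2}B_n(L(t))|=O_p(\gamma_n)\quad\text{with}\quad\gamma_n=O(n^{-1}\log n).$$ Define $H_n(t)=\int_a^t (F_n(b)-F_n(x))\,dx$ for $t\in[a,b]$, and let $\widehat H_n$ be the least concave majorant of $H_n$ on $[a,b]$. Then, as $n\to\infty$, $$\sup_{x\in[a,b]}|\widehat H_n(x)-H_n(x)|=O_p\left(\frac{\log n}{n}\right).$$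
   Context: The least concave majorant of a bounded function on an interval is the smallest concave function on that interval lying above it. ''Brownian motion or Brownian bridge on $[L(a),L(b)]$'' means the restriction to $[L(a),L(b)]$ of a standard Brownian motion $W$ with $W(0)=0$ (two-sided if needed), or of a standard Brownian bridge on $[0,1]$ (in which case $[L(a),L(b)]\subset[0,1]$). $(\gamma_n)$ is a deterministic sequence of positive numbers; $F_n$ and $B_n$ live on a common probability space. $O_p$ denotes boundedness in probability as $n\to\infty$. *)

(* Defs.v *)
From HB Require Import structures.
From mathcomp Require Import all_boot all_order all_algebra.
From mathcomp Require Import all_classical all_reals all_analysis.

Set Implicit Arguments.
Unset Strict Implicit.
Unset Printing Implicit Defensive.

Import Order.TTheory GRing.Theory Num.Theory.
Import numFieldNormedType.Exports.

Local Open Scope classical_set_scope.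
Local Open Scope ring_scope.

Definition concave_on (R : realType) (I : set R) (f : R -> R) : Prop :=
  convex_function (E := R^o) I (fun x => - f x).

Definition is_least_concave_majorant (R : realType) (I : set R)
    (g h : R -> R) : Prop :=
  [/\ concave_on I h,
      (forall x, I x -> g x <= h x) &
      forall k : R -> R, concave_on I k -> (forall x, I x -> g x <= k x) ->
        forall x, I x -> h x <= k x].

Definition cadlag_on (R : realType) (a b : R) (g : R -> R) : Prop :=
  (forall t, a <= t < b -> g x @[x --> t^'+] --> g t) /\
  (forall t, a < t <= b -> cvg (g x @[x --> t^'-])).

(* [p 0 < ... < p m] is a finite subdivision of [a, b]; the values of [g] at
   the points of the subdivision are unconstrained. *)
Definition step_function_on (R : realType) (a b : R) (g : R -> R) : Prop :=
  exists (m : nat) (p : nat -> R),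
    [/\ p 0%N = a, p m = b,
        (forall i, (i < m)%N -> p i < p i.+1) &
        forall i, (i < m)%N ->
          {in `]p i, p i.+1[ &, forall x y, g x = g y}].

(* [X] is O_p(r). Outer probability, so that the definition does not depend on
   the measurability of [X n]; it is [P] itself on measurable events. *)
Definition bounded_in_prob (d : measure_display) (T : measurableType d)
    (R : realType) (P : probability T R) (X : nat -> T -> \bar R)
    (r : nat -> R) : Prop :=
  forall eps : R, 0 < eps -> exists2 M : R, 0 < M &
    \forall n \near \oo,
      (mu_ext P [set w | ((M * r n)%:E < `|X n w|)%E] <= eps%:E)%E.

(* Law N(m, v), with variance [v]. The degenerate case is treated apart since
   [normal_prob m 0] is not the Dirac mass at [m]. *)
Definition gaussian_law (d : measure_display) (T : measurableType d)
    (R : realType) (P : probability T R) (X : T -> R) (m v : R) : Prop :=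
  forall A : set R, measurable A ->
    P (X @^-1` A) =
    if v == 0 then \d_m A else normal_prob m (Num.sqrt v) A.

Definition independent_increments (d : measure_display) (T : measurableType d)
    (R : realType) (P : probability T R) (J : set R)
    (W : R -> {RV P >-> R}) : Prop :=
  forall (k : nat) (t : nat -> R) (A : nat -> set R),
    (forall i, (i <= k)%N -> J (t i)) ->
    (forall i, (i < k)%N -> t i < t i.+1) ->
    (forall i, (i < k)%N -> measurable (A i)) ->
    P [set w | forall i, (i < k)%N -> A i (W (t i.+1) w - W (t i) w)] =
    (\prod_(i < k) P [set w | A i (W (t i.+1) w - W (t i) w)%R])%E.

(* Meant for [J] either [0, +oo[ (usual case) or the real line (two-sided). *)
Definition standard_brownian_motion (d : measure_display)
    (T : measurableType d) (R : realType) (P : probability T R) (J : set R)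
    (W : R -> {RV P >-> R}) : Prop :=
  [/\ {ae P, forall w, W 0 w = 0},
      (forall s t, J s -> J t -> s < t ->
         gaussian_law P (fun w => W t w - W s w) 0 (t - s)),
      independent_increments J W &
      {ae P, forall w, {within J, continuous (fun t => W t w)}}].

(* Centered Gaussian process on [0, 1] with covariance min(s, t) - s t and
   continuous paths; joint Gaussianity is expressed by the law of every linear
   combination. *)
Definition standard_brownian_bridge (d : measure_display)
    (T : measurableType d) (R : realType) (P : probability T R)
    (W : R -> {RV P >-> R}) : Prop :=
  (forall (k : nat) (c t : 'I_k -> R), (forall i, t i \in `[0, 1]) ->
     gaussian_law P (fun w => \sum_(i < k) c i * W (t i) w) 0
       (\sum_(i < k) \sum_(j < k)
          c i * c j * (Num.min (t i) (t j) - t i * t j))) /\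
  {ae P, forall w, {within `[0, 1], continuous (fun t => W t w)}}.

Definition is_restriction_to (d : measure_display) (T : measurableType d)
    (R : realType) (P : probability T R) (I : set R)
    (B W : R -> {RV P >-> R}) : Prop :=
  forall t, I t -> forall w, B t w = W t w.

Definition brownian_motion_on (d : measure_display) (T : measurableType d)
    (R : realType) (P : probability T R) (I : set R)
    (B : R -> {RV P >-> R}) : Prop :=
  exists (J : set R) (W : R -> {RV P >-> R}),
    [/\ J = `[0, +oo[%classic \/ J = setT, I `<=` J,
        standard_brownian_motion J W & is_restriction_to I B W].

Definition brownian_bridge_on (d : measure_display) (T : measurableType d)
    (R : realType) (P : probability T R) (I : set R)
    (B : R -> {RV P >-> R}) : Prop :=
  exists W : R -> {RV P >-> R},
    [/\ I `<=` `[0, 1], standard_brownian_bridge W & is_restriction_to I B W].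

(* Main.v *)
Require Import Defs.
From HB Require Import structures.
From mathcomp Require Import all_boot all_order all_algebra.
From mathcomp Require Import all_classical all_reals all_analysis.
From mathcomp Require Import measurable_realfun ring lra.

Set Implicit Arguments.
Unset Strict Implicit.
Unset Printing Implicit Defensive.

Import Order.TTheory GRing.Theory Num.Theory.
Import numFieldNormedType.Exports.

Local Open Scope classical_set_scope.
Local Open Scope ring_scope.

(** The integrand of [Hn] is [Fn b - Fn], that is, minus [F] up to a constant and
    up to the noise [Fn - F]. As [f] is bounded below by some [c > 0], [F] grows
    at rate at least [c], so [Hn] is the primitive of a function that decreases
    at rate at least [c], perturbed by noise. Only the fluctuation of the noise
    around a constant matters, because a constant integrates to an affine
    function.

    If this fluctuation is at most [eta], then around any point [x] a tangent
    line raised by the maximum [eta ^ 2 / (2 * c)] of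
    [eta * u - c / 2 * u ^ 2] dominates [Hn] on the whole interval
    ([primitive_le_tangent]). A line is concave, so the least concave majorant
    exceeds [Hn] by at most this amount ([concave_majorant_gap_le]). It is thus
    enough to show that [eta] is of order sqrt (log n / n), uniformly on [a, b].

    Around the constant [n^(-1/2) * B n (L a)], the fluctuation is at most
    [n^(-1/2) * K + M * gamma n], where [M * gamma n] bounds the error of the
    strong approximation and [K] bounds the oscillation of [B n] on
    [L a, L b]. By [brownian_oscillation_tight], one [K] serves for all [n] with
    probability close to 1: in both cases the increments are Gaussian with
    variance at most [t - s], and the paths are continuous, so dyadic chaining
    applies ([chaining_maximal_inequality]). Squaring,
    [eta ^ 2] is at most of order [1 / n + (log n / n) ^ 2], hence of order
    [log n / n]. *)

(** * Affine majorants and primitives *)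

Lemma concave_on_affine (R : realType) (I : set R) (p q : R) :
  concave_on I (fun x => p + q * x).
Proof.
move=> t x y _ _; rewrite !convRE /= le_eqVlt; apply/orP; left; apply/eqP.
rewrite /conv/= /GRing.scale/= /unstable.onem.
by ring.
Qed.

(** An affine function is concave, so one that lies above [g] also lies above its
    least concave majorant; its value at [x] then bounds the gap there. *)
Lemma least_concave_majorant_gap (R : realType) (I : set R) (g h : R -> R)
    (x A delta : R) :
  is_least_concave_majorant I g h -> I x ->
  (forall y, I y -> g y <= g x + A * (y - x) + delta) ->
  `|h x - g x| <= delta.
Proof.
move=> [_ gh hmin] Ix gA.
rewrite ger0_norm ?subr_ge0 ?gh// lerBlDl.
have -> : g x + delta = (g x + delta - A * x) + A * x by ring.
apply: (hmin (fun y => (g x + delta - A * x) + A * y)) => //.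
  exact: concave_on_affine.
by move=> y /gA; rewrite (_ : _ + _ + delta = g x + delta - A * x + A * y)//; ring.
Qed.

Lemma integrable_affine (R : realType) (p q x y : R) :
  lebesgue_measure.-integrable `]x, y] (EFin \o (fun t : R => p + q * t)).
Proof.
apply: (@integrableS _ _ _ lebesgue_measure `[x, y]%classic) => //.
  exact: subset_itv_oc_cc.
apply: continuous_compact_integrable; first exact: segment_compact.
apply: continuous_subspaceT => t.
apply: cvgD; first exact: cvg_cst.
by apply: cvgM; [exact: cvg_cst|exact: cvg_id].
Qed.

Lemma Rintegral_affine (R : realType) (p q x y : R) : x <= y ->
  \int[lebesgue_measure]_(t in `]x, y]) (p + q * t) =
  p * (y - x) + q * ((y ^+ 2 - x ^+ 2) / 2).
Proof.
rewrite le_eqVlt => /predU1P[->|xy].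
  by rewrite set_itv_ge ?bnd_simp// Rintegral_set0; ring.
pose G t : R := p * t + q / 2 * t ^+ 2.
have cf (t : R) : {for t, continuous (fun t : R => p + q * t)}.
  apply: cvgD; first exact: cvg_cst.
  by apply: cvgM; [exact: cvg_cst|exact: cvg_id].
have dG (t : R) : is_derive t 1 G (p + q * t).
  by apply: is_derive_eq; rewrite /GRing.scale/=; field.
have cG (t : R) : {for t, continuous G}.
  by apply: differentiable_continuous; apply/derivable1_diffP; case: (dG t).
rewrite Rintegral_itv_obnd_cbnd; last exact: integrable_affine.
rewrite /Rintegral (@continuous_FTC2 _ _ G)//.
- by rewrite -EFinB/= /G; field.
- by apply: continuous_subspaceT => t; exact: cf.
- split.
  + by move=> t _; case: (dG t).
  + by apply: cvg_at_right_filter; exact: cG.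
  + by apply: cvg_at_left_filter; exact: cG.
- by move=> t _; rewrite derive1E; apply: derive_val.
Qed.

Lemma Rintegral_itv_diff (R : realType) (a b : R) (g H : R -> R) :
  lebesgue_measure.-integrable `[a, b] (EFin \o g) ->
  (forall t, t \in `[a, b] -> H t = \int[lebesgue_measure]_(x in `[a, t]) g x) ->
  forall x y, a <= x -> x <= y -> y <= b ->
  H y - H x = \int[lebesgue_measure]_(t in `]x, y]) g t.
Proof.
move=> ig HE x y ax xy yb.
rewrite !HE ?in_itv/= ?ax ?(le_trans xy yb) ?(le_trans ax xy) ?yb//.
rewrite Rintegral_itvB ?bnd_simp//.
apply: integrableS ig => //; apply: subset_itvl; by rewrite bnd_simp.
Qed.

(** Seen from [x], [g] decreases at rate at least [c], up to an error [eta].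
    Integrating the pointwise bounds on either side of [x], the increment of the primitive is at
    most [A * (y - x) + eta * |y - x| - c / 2 * |y - x| ^ 2], and the last two
    terms never exceed [eta ^ 2 / (2 * c)]. So a line of slope [A], raised by
    that amount above the point of abscissa [x], dominates the primitive. *)
Lemma primitive_le_tangent (R : realType) (a b c eta A x : R) (g H : R -> R) :
  0 < c ->
  lebesgue_measure.-integrable `[a, b] (EFin \o g) ->
  (forall t, t \in `[a, b] -> H t = \int[lebesgue_measure]_(x in `[a, t]) g x) ->
  x \in `[a, b] ->
  (forall y, y \in `[a, b] -> x <= y -> g y <= A + eta - c * (y - x)) ->
  (forall y, y \in `[a, b] -> y <= x -> A - eta + c * (x - y) <= g y) ->
  forall y, y \in `[a, b] -> H y <= H x + A * (y - x) + eta ^+ 2 / (2 * c).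
Proof.
move=> c0 ig HE /[!in_itv]/= /andP[ax xb] gr gl y /[!in_itv]/= /andP[ay yb].
have igs u v : a <= u -> v <= b ->
    lebesgue_measure.-integrable `]u, v] (EFin \o g).
  move=> au vb; apply: integrableS ig => // t /=; rewrite !in_itv/=.
  by move=> /andP[ut tv]; rewrite (le_trans au (ltW ut)) (le_trans tv vb).
suff : H y <= H x + A * (y - x) + eta * `|y - x| - c / 2 * `|y - x| ^+ 2.
  move=> /le_trans; apply.
  (* The slack is the square completed in |y - x|. *)
  rewrite -subr_ge0; set z := `|y - x|.
  rewrite (_ : _ - _ = (eta - c * z) ^+ 2 / (2 * c)); last by field; rewrite gt_eqF.
  by rewrite divr_ge0 ?sqr_ge0// mulr_ge0// ltW.
have [xy|yx] := leP x y.
- rewrite ger0_norm ?subr_ge0//.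
  suff : H y - H x <= A * (y - x) + eta * (y - x) - c / 2 * (y - x) ^+ 2 by lra.
  rewrite (Rintegral_itv_diff ig HE)//.
  apply: (@le_trans _ _ (\int[lebesgue_measure]_(t in `]x, y])
      ((A + eta + c * x) + (- c) * t))).
    apply: le_Rintegral => //; [exact: igs|exact: integrable_affine|].
    move=> t /=; rewrite in_itv/= => /andP[xt ty].
    have := gr t; rewrite in_itv/= (le_trans ax (ltW xt)) (le_trans ty yb).
    by move=> /(_ isT (ltW xt)); lra.
  rewrite Rintegral_affine// le_eqVlt; apply/orP; left; apply/eqP; by field.
- have {}yx := ltW yx; rewrite distrC ger0_norm ?subr_ge0//.
  suff : (A - eta) * (x - y) + c / 2 * (x - y) ^+ 2 <= H x - H y by lra.
  rewrite (Rintegral_itv_diff ig HE)//.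
  apply: (@le_trans _ _ (\int[lebesgue_measure]_(t in `]y, x])
      ((A - eta + c * x) + (- c) * t))); last first.
    apply: le_Rintegral => //; [exact: integrable_affine|exact: igs|].
    move=> t /=; rewrite in_itv/= => /andP[yt tx].
    have := gl t; rewrite in_itv/= (le_trans ay (ltW yt)) (le_trans tx xb).
    by move=> /(_ isT tx); lra.
  rewrite Rintegral_affine// le_eqVlt; apply/orP; left; apply/eqP; by field.
Qed.

(** * The gap of a perturbed concave primitive *)

(** Induction on the points of the subdivision: each new point adds an open
    interval where [g] is constant, and one singleton. *)
Lemma step_function_measurable_bounded (R : realType) (a b : R) (g : R -> R) :
  step_function_on a b g ->
  measurable_fun `[a, b] g /\ [bounded g x | x in `[a, b]].
Proof.
move=> [m [p [<- <- pinc pcst]]].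
suff : forall k, (k <= m)%N -> p 0%N <= p k /\
    measurable_fun `[p 0%N, p k] g /\
    exists C : R, forall x, x \in `[p 0%N, p k] -> `|g x| <= C.
  move=> /(_ m (leqnn m))[_ [mg [C gC]]]; split => //.
  exists C; split; first exact: num_real.
  by move=> C' CC' x /= xI; apply: le_trans (gC _ xI) (ltW CC').
elim=> [_|k IH km].
  split => //; rewrite set_itv1; split; first exact: measurable_fun_set1.
  exists `|g (p 0%N)| => x; rewrite in_itv/= -eq_le => /eqP <-//.
have [p0k [mg [C gC]]] := IH (ltnW km).
have pk := pinc k km.
have E : `[p 0%N, p k.+1]%classic =
    `[p 0%N, p k] `|` `]p k, p k.+1[ `|` [set p k.+1].
  apply/seteqP; split => x /=.
    rewrite !in_itv/= => /andP[x0].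
    rewrite le_eqVlt => /predU1P[->|xk]; first by right.
    by left; case: (leP x (p k)) => kx; [left|right];
      rewrite ?x0 ?kx ?xk.
  rewrite !in_itv/= => -[[/andP[-> xk /=]|/andP[kx xk]]|->].
  - exact: le_trans xk (ltW pk).
  - by rewrite (le_trans p0k (ltW kx)) ltW.
  - by rewrite (le_trans p0k (ltW pk)) lexx.
split; first exact: le_trans p0k (ltW pk).
pose z := (p k + p k.+1) / 2.
have zI : z \in `]p k, p k.+1[ by rewrite in_itv/= !midf_lt.
split.
  rewrite E; apply/measurable_funU => //; first exact: measurableU.
  split; last exact: measurable_fun_set1.
  apply/measurable_funU => //; split => //.
  apply: (eq_measurable_fun (cst (g z))) => // x /set_mem/= xI.
  exact: (pcst k).
exists (Num.max C (Num.max `|g z| `|g (p k.+1)|)) => x.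
move=> xI; have : `[p 0%N, p k.+1]%classic x by [].
rewrite E !le_max => -[[/gC ->//|/= xk]|-> /=]; last by rewrite lexx !orbT.
by rewrite (pcst k km x z xk zI) lexx !orbT.
Qed.

(** Here [F] is the drift and [eta] bounds the fluctuation of [G - F] around a
    constant [e0]. Only this fluctuation matters, since a constant in the
    integrand changes [H] by an affine function. The gap is quadratic in [eta],
    whence the square of the usual root-n rate. *)
Lemma concave_majorant_gap_le (R : realType) (a b c eta e0 : R) (F G H Hhat : R -> R) :
  0 < c ->
  {in `[a, b] &, forall x y, x <= y -> c * (y - x) <= F y - F x} ->
  step_function_on a b G ->
  {in `[a, b], forall x, `|G x - F x - e0| <= eta} ->
  {in `[a, b], forall t,
    H t = \int[lebesgue_measure]_(x in `[a, t]) (G b - G x)} ->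
  is_least_concave_majorant `[a, b] H Hhat ->
  {in `[a, b], forall x, `|Hhat x - H x| <= eta ^+ 2 / (2 * c)}.
Proof.
move=> c0 Fc stepG GF HE lcmH x xI.
apply: (least_concave_majorant_gap lcmH xI) => y yI.
have iG : lebesgue_measure.-integrable `[a, b] (EFin \o G).
  have [mG bG] := step_function_measurable_bounded stepG.
  apply: measurable_bounded_integrable => //.
  exact: compact_finite_measure (@segment_compact _ _ _).
have icst r : lebesgue_measure.-integrable `[a, b] (EFin \o cst r).
  apply: continuous_compact_integrable; first exact: segment_compact.
  by apply: continuous_subspaceT => t; exact: cvg_cst.
(* The slope is the noise-free value of the integrand at x, shifted by the
   constant part e0 of the noise. *)
apply: (@primitive_le_tangent _ a b c eta (G b - F x - e0) x (fun t => G b - G t)) => //.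
- by have := integrableB _ (icst (G b)) iG; apply.
- move=> z zI xz; have := Fc _ _ xI zI xz; have := GF z zI.
  by rewrite ler_norml => /andP[]; lra.
- move=> z zI xz; have := Fc _ _ zI xI xz; have := GF z zI.
  by rewrite ler_norml => /andP[]; lra.
Qed.

(** * Gaussian tails *)

Lemma expRN_le_sqr (R : realType) (u : R) : 0 < u -> expR (- u) <= 2 / u ^+ 2.
Proof.
move=> u0; rewrite expRN -[leRHS]invrK lef_pV2 ?posrE ?expR_gt0 ?invr_gt0//; last first.
  by rewrite divr_gt0// exprn_gt0.
rewrite invf_div; have := @expR_ge1Dxn R u 1 (ltW u0).
by rewrite (_ : 2`!%:R = 2)//; apply: le_trans; rewrite lerDr.
Qed.

(** Far from the mean, a centred normal density is a small multiple of the one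
    with twice the standard deviation. Integrated, this gives a tail bound of
    fourth-moment type that uses only the total mass of the wider law. *)
Lemma normal_pdf_le_wide (R : realType) (s x y : R) :
  0 < s -> 0 < x -> x <= `|y| ->
  normal_pdf 0 s y <= 32 * s ^+ 4 / x ^+ 4 * normal_pdf 0 (2 * s) y.
Proof.
move=> s0 x0 xy.
have s20 : 0 < 2 * s by rewrite mulr_gt0.
rewrite !normal_pdfE ?gt_eqF// /normal_fun !subr0.
have -> : normal_peak (2 * s) = normal_peak s / 2.
  rewrite /normal_peak -invfM; congr (_^-1).
  rewrite (_ : (2 * s) ^+ 2 * pi *+ 2 = (s ^+ 2 * pi *+ 2) * 2 ^+ 2); last first.
    by ring.
  rewrite sqrtrM; first by rewrite sqrtr_sqr ger0_norm.
  by rewrite mulrn_wge0// mulr_ge0 ?sqr_ge0// pi_ge0.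
(* The exponent 1/(2 s^2) splits as 3/(8 s^2), which gives the decay, plus
   1/(2 (2 s)^2), which rebuilds the wider density. *)
have -> : expR (- y ^+ 2 / (s ^+ 2 *+ 2)) =
    expR (- (3 * y ^+ 2 / (8 * s ^+ 2))) * expR (- y ^+ 2 / ((2 * s) ^+ 2 *+ 2)).
  rewrite -expRD; congr expR; field; by rewrite gt_eqF.
set E := expR (- y ^+ 2 / _).
suff H : expR (- (3 * y ^+ 2 / (8 * s ^+ 2))) <= 16 * s ^+ 4 / x ^+ 4.
  have := normal_peak_ge0 s; set p := normal_peak s => p0.
  have E0 : 0 <= E by exact: expR_ge0.
  rewrite [leRHS](_ : _ = p * E * (16 * s ^+ 4 / x ^+ 4)); last by field; rewrite gt_eqF.
  rewrite [leLHS](_ : _ = p * E * expR (- (3 * y ^+ 2 / (8 * s ^+ 2)))); last by ring.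
  by apply: ler_wpM2l => //; exact: mulr_ge0.
have xy2 : x ^+ 2 <= y ^+ 2.
  by rewrite -[y ^+ 2]real_normK ?num_real// ler_pXn2r ?nnegrE// ltW.
apply: (@le_trans _ _ (expR (- (3 * x ^+ 2 / (8 * s ^+ 2))))).
  rewrite ler_expR lerN2 ler_pM2r ?ler_pM2l//.
  by rewrite invr_gt0 mulr_gt0// exprn_gt0.
apply: le_trans (expRN_le_sqr _) _.
  by rewrite divr_gt0// mulr_gt0// exprn_gt0.
rewrite [leLHS](_ : _ = (128 / 9) * (s ^+ 4 / x ^+ 4)); last first.
  by field; rewrite !gt_eqF.
rewrite -[leRHS]mulrA ler_wpM2r//; last by lra.
by rewrite divr_ge0// exprn_ge0// ltW.
Qed.

Lemma measurable_norm_gt (R : realType) (x : R) :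
  measurable [set y : R | x < `|y|].
Proof.
rewrite (_ : [set y | _] = Num.norm @^-1` `]x, +oo[%classic); last first.
  by apply/seteqP; split => y /=; rewrite in_itv/= andbT.
rewrite -[X in measurable X]setTI.
exact: (@normr_measurable _ setT).
Qed.

Lemma normal_prob_tail (R : realType) (s x : R) : 0 < s -> 0 < x ->
  (normal_prob 0 s [set y | (x < `|y|)%R] <= (32 * s ^+ 4 / x ^+ 4)%:E)%E.
Proof.
move=> s0 x0; set V : set R := [set y | _].
have mV : measurable V by exact: measurable_norm_gt.
rewrite /normal_prob; set k := 32 * _ / _.
have k0 : 0 <= k by rewrite !(divr_ge0, mulr_ge0, exprn_ge0)// ?ltW.
apply: (@le_trans _ _
    (\int[lebesgue_measure]_(y in V) (k%:E * (normal_pdf 0 (2 * s) y)%:E))%E).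
  apply: ge0_le_integral => //.
  - by move=> y _; rewrite lee_fin normal_pdf_ge0.
  - apply/measurable_EFinP; apply: measurable_funS (measurable_normal_pdf _ _) => //.
  - apply: measurable_funeM; apply/measurable_EFinP.
    apply: measurable_funS (measurable_normal_pdf _ _) => //.
  - move=> y /= xy; rewrite -EFinM lee_fin.
    exact: normal_pdf_le_wide (ltW xy).
rewrite ge0_integralZl//; last 2 first.
- apply/measurable_EFinP; apply: measurable_funS (measurable_normal_pdf _ _) => //.
- by move=> y _; rewrite lee_fin normal_pdf_ge0.
rewrite -[leRHS]mule1; apply: lee_wpmul2l; first by rewrite lee_fin.
exact: (@probability_le1 _ _ _ (normal_prob 0 (2 * s)) V mV).
Qed.

(** The fourth power of [x] comes with the square of the variance; for a process
    whose increments have variance at most [t - s], this exponent 2 > 1 is what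
    makes the chaining sums converge. *)
Lemma gaussian_law_tail (d : measure_display) (T : measurableType d)
    (R : realType) (P : probability T R) (X : T -> R) (v x : R) :
  gaussian_law P X 0 v -> 0 <= v -> 0 < x ->
  (P [set w | (x < `|X w|)%R] <= (32 * v ^+ 2 / x ^+ 4)%:E)%E.
Proof.
move=> GX v0 x0.
have /= -> := GX _ (measurable_norm_gt x).
case: eqP => [_|/eqP vN0].
  rewrite diracE memNset/=; last by rewrite normr0 ltNge ltW.
  by rewrite lee_fin divr_ge0 ?mulr_ge0 ?exprn_ge0// ltW.
have vp : 0 < v by rewrite lt_neqAle eq_sym vN0.
apply: le_trans (normal_prob_tail _ x0) _; first by rewrite sqrtr_gt0.
by rewrite lee_fin (exprM _ 2 2) sqr_sqrtr.
Qed.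

(** * Chaining along dyadic points *)

Definition dyadic (R : realType) (al be : R) (k i : nat) : R :=
  al + (be - al) * (i%:R / 2 ^+ k).

Lemma dyadic0 (R : realType) (al be : R) k : dyadic al be k 0 = al.
Proof. by rewrite /dyadic mul0r mulr0 addr0. Qed.

Lemma dyadic_double (R : realType) (al be : R) k i :
  dyadic al be k.+1 i.*2 = dyadic al be k i.
Proof.
rewrite /dyadic -muln2 natrM exprSr invfM mulrACA divff ?mulr1//.
Qed.

Lemma dyadic_gap (R : realType) (al be : R) k i :
  dyadic al be k i.+1 - dyadic al be k i = (be - al) / 2 ^+ k.
Proof. by rewrite /dyadic -natr1; ring. Qed.

Lemma dyadic_itv (R : realType) (al be : R) k i : al <= be -> (i <= 2 ^ k)%N ->
  dyadic al be k i \in `[al, be].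
Proof.
move=> albe ik; have k0 : 0 < (2 : R) ^+ k by rewrite exprn_gt0.
have i0 : 0 <= i%:R / (2 : R) ^+ k by rewrite divr_ge0// ltW.
have i1 : i%:R / (2 : R) ^+ k <= 1 by rewrite ler_pdivrMr// mul1r -natrX ler_nat.
rewrite in_itv/= /dyadic lerDl mulr_ge0 ?subr_ge0//=.
by rewrite -lerBrDl ler_piMr// subr_ge0.
Qed.

Lemma dyadic_bracket (R : realType) (al be t : R) k : t \in `[al, be] ->
  exists2 i, (i < 2 ^ k)%N & dyadic al be k i <= t <= dyadic al be k i.+1.
Proof.
rewrite in_itv/= => tI; elim: k => [|k [i ik /andP[it ti]]].
  by exists 0%N => //; rewrite dyadic0 /dyadic divr1 mulr1 addrC subrK.
have e2 : (2 ^ k.+1 = (2 ^ k).*2)%N by rewrite expnS mul2n.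
have [tm|mt] := leP t (dyadic al be k.+1 i.*2.+1).
  exists i.*2; first by rewrite e2 ltn_double.
  by rewrite dyadic_double it.
exists i.*2.+1; first by rewrite e2 ltn_Sdouble.
by rewrite (ltW mt) -doubleS dyadic_double.
Qed.

(** A point of level [k + 1] is either a point of level [k] or the right
    neighbour, at level [k + 1], of one. Hence every dyadic point is reached from
    [al] by at most one step per level, and the steps sum geometrically. *)
Lemma dyadic_chaining (R : realType) (al be r M : R) (phi : R -> R) :
  0 <= M -> 0 < r < 1 ->
  (forall k i, (i < 2 ^ k)%N ->
    `|phi (dyadic al be k i.+1) - phi (dyadic al be k i)| <= M * r ^+ k) ->
  forall k i, (i <= 2 ^ k)%N ->
    `|phi (dyadic al be k i) - phi al| <= M / (1 - r).
Proof.
move=> M0 /andP[r0 r1] step k i ik.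
suff : `|phi (dyadic al be k i) - phi al| <= series (geometric M r) k.+1.
  move=> /le_trans; apply; apply: geometric_le_lim => //.
  by rewrite ger0_norm// ltW.
have geoS n : series (geometric M r) n.+1 = series (geometric M r) n + M * r ^+ n.
  by rewrite /series/= big_nat_recr.
elim: k i ik => [|k IH] i ik.
  rewrite geoS /series/= big_geq// add0r.
  move: ik; rewrite expn0 leq_eqVlt ltnS leqn0 => /orP[] /eqP -> //.
    by rewrite -[X in phi _ - phi X](dyadic0 al be 0) step.
  by rewrite dyadic0 subrr normr0 mulr_ge0// exprn_ge0// ltW.
rewrite geoS; have e2 : (2 ^ k.+1 = (2 ^ k).*2)%N by rewrite expnS mul2n.
have i2 : i = (odd i + i./2.*2)%N by rewrite odd_double_half.
have rk : 0 <= M * r ^+ k.+1 by rewrite mulr_ge0// exprn_ge0// ltW.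
have [oi|ei] := boolP (odd i); rewrite i2 ?oi ?(negbTE ei) ?add0n ?add1n.
- have hk : (i./2 < 2 ^ k)%N by rewrite -ltn_double -e2; move: ik; rewrite {1}i2 oi add1n.
  apply: le_trans (_ : _ <= `|phi (dyadic al be k.+1 i./2.*2) - phi al| +
    `|phi (dyadic al be k.+1 i./2.*2.+1) - phi (dyadic al be k.+1 i./2.*2)|) _.
    by rewrite [leRHS]addrC; exact: ler_distD.
  rewrite lerD//; first by rewrite dyadic_double IH// ltnW.
  by apply: step; rewrite e2 ltn_double.
- rewrite dyadic_double (le_trans (IH _ _)) ?lerDl//.
  by rewrite -leq_double -e2; move: ik; rewrite {1}i2 (negbTE ei).
Qed.

Lemma chaining_continuous (R : realType) (al be r M : R) (phi : R -> R) :
  0 <= M -> 0 < r < 1 ->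
  {within `[al, be], continuous phi} ->
  (forall k i, (i < 2 ^ k)%N ->
    `|phi (dyadic al be k i.+1) - phi (dyadic al be k i)| <= M * r ^+ k) ->
  forall t, t \in `[al, be] -> `|phi t - phi al| <= M / (1 - r).
Proof.
move=> M0 r01 cphi step t tI.
have albe : al <= be by move: tI; rewrite in_itv/= => /andP[]; exact: le_trans.
rewrite leNgt; apply/negP => Kt.
have /subspace_continuousP/(_ t tI) := cphi.
(* A dyadic point close to t would contradict the bound on dyadic points. *)
pose e := `|phi t - phi al| - M / (1 - r).
have e0 : 0 < e by rewrite subr_gt0.
move=> /(@cvgrPdist_lt _ R^o)/(_ e e0); rewrite near_withinE.
move=> /nbhs_ballP[del /= del0 near_t].
have [k hk] : exists k, (be - al) / 2 ^+ k < del.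
  exists (Num.bound `|(be - al) / del|).
  rewrite ltr_pdivrMr ?exprn_gt0// mulrC -ltr_pdivrMr//.
  apply: (le_lt_trans (ler_norm _)).
  apply: lt_le_trans (archi_boundP (normr_ge0 _)) _.
  by rewrite -natrX ler_nat ltnW// ltn_expl.
have [i ik /andP[it ti]] := dyadic_bracket k tI.
have iI := dyadic_itv albe (ltnW ik).
have := near_t (dyadic al be k i) _ iI.
rewrite /ball/= ger0_norm ?subr_ge0// => /(_ _)/wrap[].
  apply: le_lt_trans hk; rewrite -(dyadic_gap al be k i); lra.
have := dyadic_chaining M0 r01 step (ltnW ik).
rewrite /e; have := ler_distD (phi (dyadic al be k i)) (phi t) (phi al); lra.
Qed.

(** Kolmogorov's chaining argument, with moment exponent 4 and increments of
    order [(t - s) ^ 2]. Outer measure is used because the event involves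
    uncountably many times. *)
Lemma chaining_maximal_inequality (d : measure_display) (T : measurableType d)
    (R : realType) (P : probability T R) (X : R -> {RV P >-> R})
    (al be C : R) :
  al <= be -> 0 <= C ->
  (forall s t x, s \in `[al, be] -> t \in `[al, be] -> s <= t -> 0 < x ->
    (P [set w | (x < `|X t w - X s w|)%R] <=
      (C * (t - s) ^+ 2 / x ^+ 4)%:E)%E) ->
  {ae P, forall w, {within `[al, be], continuous (fun t => X t w)}} ->
  forall M, 0 < M ->
  (mu_ext P [set w | ~ {in `[al, be], forall t,
      (`|X t w - X al w| <= 10 * M)%R}] <=
    (5 * C * (be - al) ^+ 2 / M ^+ 4)%:E)%E.
Proof.
move=> albe C0 tail [N [mN PN0 sN]] M M0.
(* The union bound at level k sums to a multiple of (2 r^4)^-k, so the ratio r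
   must exceed 2^(-1/4) ~ 0.84; the factor 10 of the statement is 1/(1 - r). *)
pose r : R := 9 / 10.
have r01 : 0 < r < 1 by rewrite /r; lra.
have r0 : 0 < r by case/andP: r01.
pose D k i := [set w | M * r ^+ k <
  `|X (dyadic al be k i.+1) w - X (dyadic al be k i) w|].
pose A k := \big[setU/set0]_(i < 2 ^ k) D k i.
have sub : [set w | ~ {in `[al, be], forall t, `|X t w - X al w| <= 10 * M}]
    `<=` (\bigcup_k A k) `|` N.
  move=> w /= nX; apply: contrapT => /not_orP[nA nN]; apply: nX => t tI.
  have -> : 10 * M = M / (1 - r) by rewrite /r; field.
  apply: (@chaining_continuous _ al be r M (fun t => X t w)) => //.
  - exact: ltW.
  - by apply: contrapT => /sN.
  - move=> k i ik; rewrite leNgt; apply/negP => Dw; apply: nA.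
    exists k => //; rewrite /A -bigcup_mkord; exists i => //.
apply: le_trans (le_mu_ext P sub) _.
apply: le_trans (outer_measureU2 _ _ _) _.
have PN : mu_ext P N = 0%E by rewrite measurable_mu_extE.
rewrite -[leRHS]adde0; apply: leeD; last by rewrite -PN.
apply: le_trans (outer_measure_sigma_subadditive _ _) _.
set ell := be - al.
pose rho : R := (2 * r ^+ 4)^-1.
have DP k i : (i < 2 ^ k)%N ->
    (mu_ext P (D k i) <= (C * (ell / 2 ^+ k) ^+ 2 / (M * r ^+ k) ^+ 4)%:E)%E.
  move=> ik; rewrite measurable_mu_extE; last first.
    rewrite /D -[X in measurable X]setTI.
    have mY : measurable_fun setT (fun w => `|X (dyadic al be k i.+1) w - X (dyadic al be k i) w|).
      by apply: measurableT_comp => //; apply: measurable_funB.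
    have := mY measurableT `]M * r ^+ k, +oo[%classic (measurable_itv _).
    by congr measurable; apply/seteqP; split => w /=; rewrite in_itv/= andbT.
  rewrite /ell -(dyadic_gap al be k i); apply: tail.
  - by apply: dyadic_itv => //; exact: ltnW.
  - exact: dyadic_itv.
  - by rewrite -subr_ge0 dyadic_gap divr_ge0 ?exprn_ge0// subr_ge0.
  - by rewrite mulr_gt0// exprn_gt0.
have AP k : (mu_ext P (A k) <= (geometric (C * ell ^+ 2 / M ^+ 4) rho k)%:E)%E.
  apply: le_trans (outer_measure_subadditive _ _ _) _.
  apply: (@le_trans _ _ (\sum_(i < 2 ^ k)
      (C * (ell / 2 ^+ k) ^+ 2 / (M * r ^+ k) ^+ 4)%:E)%E).
    by apply: lee_sum => i _; exact: DP.
  rewrite sumEFin lee_fin sumr_const card_ord -[_ *+ (2 ^ k)]mulr_natl natrX /=.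
  rewrite /rho le_eqVlt; apply/orP; left; apply/eqP.
  rewrite exprVn [(2 * _) ^+ k]exprMn [(r ^+ 4) ^+ k]exprAC.
  have : (2 : R) ^+ k != 0 by rewrite expf_neq0.
  have : r ^+ k != 0 by rewrite expf_neq0// gt_eqF.
  move: ((2 : R) ^+ k) (r ^+ k) => x y y0 x0.
  by field; rewrite x0 y0 gt_eqF.
have cst0 : 0 <= C * ell ^+ 2 / M ^+ 4.
  by rewrite divr_ge0 ?mulr_ge0 ?subr_ge0// ltW.
have rho0 : 0 < rho by rewrite invr_gt0 mulr_gt0// exprn_gt0.
apply: (@le_trans _ _ (\sum_(k <oo)
    (geometric (C * ell ^+ 2 / M ^+ 4) rho k)%:E)%E).
  by apply: lee_nneseries => k _; [move=> _; exact: mu_ext_ge0|exact: AP].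
apply: lime_le.
  apply: is_cvg_nneseries => k _ _; rewrite lee_fin mulr_ge0// exprn_ge0//.
  exact: ltW.
apply: nearW => n; rewrite sumEFin lee_fin.
have rho1 : rho < 4 / 5 by rewrite /rho /r; lra.
apply: le_trans (geometric_le_lim n cst0 rho0 _) _.
  by rewrite gtr0_norm//; lra.
rewrite [leRHS](_ : _ = C * ell ^+ 2 / M ^+ 4 * 5); last by field; rewrite gt_eqF.
rewrite ler_wpM2l//; rewrite invf_ple ?posrE; lra.
Qed.

(** * Oscillation of Brownian motion and Brownian bridge *)

(** The increment is the linear combination with coefficients 1 and -1 of the
    values at [t] and [s]. *)
Lemma bridge_increment_law (d : measure_display) (T : measurableType d)
    (R : realType) (P : probability T R) (W : R -> {RV P >-> R}) (s t : R) :
  standard_brownian_bridge W -> s \in `[0, 1] -> t \in `[0, 1] -> s <= t ->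
  gaussian_law P (fun w => W t w - W s w) 0 ((t - s) - (t - s) ^+ 2).
Proof.
move=> [GW _] sI tI st.
have := GW 2 (fun i => if i == ord0 then 1 else -1)
  (fun i => if i == ord0 then t else s).
have -> : (fun w => \sum_(i < 2) (if i == ord0 then 1 else -1) *
    W (if i == ord0 then t else s) w) = (fun w => W t w - W s w).
  by apply/funext => w; rewrite !big_ord_recl big_ord0/=; ring.
rewrite !big_ord_recl !big_ord0/= !minxx (min_r st) (min_l st).
set v := (X in (_ -> gaussian_law _ _ _ X) -> _).
rewrite (_ : v = t - s - (t - s) ^+ 2); last by rewrite /v; ring.
by apply => i; case: ifP.
Qed.

(** Brownian motion and Brownian bridge share the property on which, along with
    path continuity, the chaining argument rests: an increment is Gaussian with
    variance at most [t - s]. *)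
Lemma brownian_increment_tail (d : measure_display) (T : measurableType d)
    (R : realType) (P : probability T R) (I : set R) (B : R -> {RV P >-> R}) :
  brownian_motion_on I B \/ brownian_bridge_on I B ->
  forall s t x, I s -> I t -> s <= t -> 0 < x ->
  (P [set w | (x < `|B t w - B s w|)%R] <= (32 * (t - s) ^+ 2 / x ^+ 4)%:E)%E.
Proof.
move=> BB s t x Is It; rewrite le_eqVlt => /predU1P[<- x0|st x0].
  rewrite (_ : [set w | _] = set0) ?measure0 ?subrr ?expr0n ?mulr0 ?mul0r//.
  by apply/seteqP; split => // w /=; rewrite subrr normr0 ltNge ltW.
case: BB => [[J [W [_ IJ [_ GW _ _] BW]]]|[W [I01 WB BW]]].
  rewrite (_ : [set w | _] = [set w | x < `|W t w - W s w|]); last first.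
    by apply/seteqP; split => w /=; rewrite !BW.
  apply: gaussian_law_tail => //; last by rewrite subr_ge0 ltW.
  by apply: GW => //; exact: IJ.
rewrite (_ : [set w | _] = [set w | x < `|W t w - W s w|]); last first.
  by apply/seteqP; split => w /=; rewrite !BW.
have sI : s \in `[0, 1] by exact: I01.
have tI : t \in `[0, 1] by exact: I01.
have v0 : 0 <= t - s - (t - s) ^+ 2.
  move: sI tI; rewrite !in_itv/= => /andP[s0 _] /andP[_ t1].
  rewrite (_ : _ - _ = (t - s) * (1 - (t - s))); last by ring.
  by rewrite mulr_ge0//; lra.
apply: le_trans (gaussian_law_tail (bridge_increment_law WB sI tI (ltW st)) v0 x0) _.
rewrite lee_fin ler_pM2r ?invr_gt0 ?exprn_gt0// ler_pM2l//.
rewrite ler_pXn2r ?nnegrE//; last by rewrite subr_ge0 ltW.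
by rewrite gerBl sqr_ge0.
Qed.

Lemma brownian_continuous (d : measure_display) (T : measurableType d)
    (R : realType) (P : probability T R) (I : set R) (B : R -> {RV P >-> R}) :
  brownian_motion_on I B \/ brownian_bridge_on I B ->
  {ae P, forall w, {within I, continuous (fun t => B t w)}}.
Proof.
have restr (J : set R) (W : R -> {RV P >-> R}) w : I `<=` J ->
    is_restriction_to I B W ->
    {within J, continuous (fun t => W t w)} ->
    {within I, continuous (fun t => B t w)}.
  move=> IJ BW cW; have := continuous_subspaceW IJ cW.
  apply: subspace_eq_continuous => t /set_mem It; exact/esym/BW.
move=> [[J [W [_ IJ [_ _ _ cW] BW]]]|[W [I01 [_ cW] BW]]].
  by apply: filterS cW => w; exact: restr.
by apply: filterS cW => w; exact: restr.
Qed.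

(** The constant [K] is chosen before the process, so one [K] serves a whole
    sequence of such processes. *)
Lemma brownian_oscillation_tight (d : measure_display) (T : measurableType d)
    (R : realType) (P : probability T R) (al be eps : R) : al <= be -> 0 < eps ->
  exists2 K : R, 0 < K & forall B : R -> {RV P >-> R},
  brownian_motion_on `[al, be] B \/ brownian_bridge_on `[al, be] B ->
  (mu_ext P [set w | ~ {in `[al, be], forall t, (`|B t w - B al w| <= K)%R}] <=
    eps%:E)%E.
Proof.
move=> albe eps0.
pose c := 5 * 32 * (be - al) ^+ 2 / eps.
have c0 : 0 <= c.
  apply: divr_ge0; last exact: ltW.
  by apply: mulr_ge0; [exact: mulr_ge0|exact: sqr_ge0].
(* With M = 1 + c the bound is eps * c / M^4 <= eps, because c <= M <= M^4. *)
have M1 : 1 <= 1 + c by lra.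
exists (10 * (1 + c)); first by rewrite mulr_gt0//; lra.
move=> B HB.
have := @chaining_maximal_inequality _ _ _ P B al be 32 albe _ _ _ (1 + c).
move=> /(_ _ _ (brownian_continuous HB) _)/le_trans; apply => //.
- by move=> s t x sI tI; exact: (brownian_increment_tail HB sI tI).
- by lra.
rewrite lee_fin ler_pdivrMr ?exprn_gt0//; last by lra.
rewrite (_ : 5 * 32 * _ = eps * c); last by rewrite /c; field; rewrite gt_eqF.
rewrite ler_pM2l//; apply: (@le_trans _ _ (1 + c)); first by lra.
by rewrite ler_eXnr.
Qed.

(** * Rates and conclusion *)

Lemma pos_inf_lower_bound (R : realType) (D : set R) (f : R -> R) :
  D !=set0 -> (0 < ereal_inf [set (f t)%:E | t in D])%E ->
  exists2 c : R, 0 < c & forall t, D t -> c <= f t.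
Proof.
move=> [x Dx] inf0.
have lb t : D t -> (ereal_inf [set (f t)%:E | t in D] <= (f t)%:E)%E.
  by move=> Dt; apply: ereal_inf_lbound; exists t.
move: (ereal_inf _) inf0 lb => [c|_ /(_ x Dx)|] //; rewrite ?leye_eq//.
by rewrite lte_fin => c0 lb; exists c.
Qed.

Lemma primitive_increment_ge (R : realType) (a b c : R) (f F : R -> R) :
  {within `[a, b], continuous f} ->
  {in `[a, b], forall t, c <= f t} ->
  (forall t, t \in `[a, b] -> F t = \int[lebesgue_measure]_(x in `[a, t]) f x) ->
  {in `[a, b] &, forall x y, x <= y -> c * (y - x) <= F y - F x}.
Proof.
move=> cf fc HF x y /[!in_itv]/= /andP[ax xb] /andP[ay yb] xy.
have fi : lebesgue_measure.-integrable `[a, b] (EFin \o f).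
  by apply: continuous_compact_integrable => //; exact: segment_compact.
rewrite (Rintegral_itv_diff fi HF)//.
rewrite [leLHS](_ : _ = \int[lebesgue_measure]_(t in `]x, y]) (c + 0 * t)); last first.
  by rewrite Rintegral_affine//; ring.
have sub : `]x, y] `<=` `[a, b].
  move=> t /=; rewrite !in_itv/= => /andP[xt ty].
  by rewrite (le_trans ax (ltW xt)) (le_trans ty yb).
apply: le_Rintegral => //; first exact: integrable_affine.
- exact: integrableS fi.
- by move=> t /sub tI; rewrite mul0r addr0; exact: fc.
Qed.

Lemma powR_Nhalf_sqr (R : realType) (x : R) : 0 <= x ->
  (x `^ (- 2^-1)) ^+ 2 = x^-1.
Proof.
move=> x0; rewrite -powR_mulrn ?powR_ge0// -powRrM.
by rewrite mulNr mulVf// powR_inv1.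
Qed.

(** The noise level has a part of order n^(-1/2) and a part of order [lam], with
    [lam] = log n / n. Squared, both are of order [lam]: the first because
    1 / n <= [lam], the second because [lam ^ 2 <= lam]. *)
Lemma sqrD_rate_le (R : realType) (K M C lam q g : R) :
  0 <= lam <= 1 -> q ^+ 2 <= lam -> `|g| <= C * lam ->
  (q * K + M * g) ^+ 2 <= (2 * K ^+ 2 + 2 * (M * C) ^+ 2) * lam.
Proof.
move=> /andP[l0 l1] ql gl.
have g2 : g ^+ 2 <= C ^+ 2 * lam.
  apply: (@le_trans _ _ ((C * lam) ^+ 2)).
    rewrite -[g ^+ 2]real_normK ?num_real// ler_pXn2r ?nnegrE//.
    exact: le_trans gl.
  rewrite exprMn ler_wpM2l ?sqr_ge0//.
  by rewrite expr2 ler_piMr.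
have qK : q ^+ 2 * K ^+ 2 <= lam * K ^+ 2 by rewrite ler_wpM2r ?sqr_ge0.
have gM : M ^+ 2 * g ^+ 2 <= M ^+ 2 * (C ^+ 2 * lam) by rewrite ler_wpM2l ?sqr_ge0.
have := sqr_ge0 (q * K - M * g).
rewrite sqrrB sqrrD !exprMn; lra.
Qed.

Theorem corollary3p5 (R : realType) (a b : R) (hab : a < b)
  (f : R -> R)
  (hfcont : {within `[a, b], continuous f})
  (hfinf : (0 < ereal_inf [set (f t)%:E | t in `[a, b]])%E)
  (hfsup : (ereal_sup [set (f t)%:E | t in `[a, b]] < +oo)%E)
  (F : R -> R)
  (hF : forall t, t \in `[a, b] ->
    F t = \int[lebesgue_measure]_(x in `[a, t]) f x)
  (L : R -> R)
  (hLmono : {in `[a, b] &, {homo L : s t / s <= t}})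
  (hLbnd : [bounded (L t : R^o) | t in `[a, b]])
  (d : measure_display) (T : measurableType d) (P : probability T R)
  (B : nat -> R -> {RV P >-> R})
  (hB : forall n, (0 < n)%N ->
    brownian_motion_on `[L a, L b] (B n) \/
    brownian_bridge_on `[L a, L b] (B n))
  (Fn : nat -> R -> {RV P >-> R})
  (hFn : forall n, (0 < n)%N -> forall w,
    cadlag_on a b (fun t => Fn n t w) /\
    step_function_on a b (fun t => Fn n t w))
  (gamma : nat -> R)
  (hgamma_pos : forall n, (0 < n)%N -> 0 < gamma n)
  (hgamma : (gamma : nat -> R^o) =O_\oo
    (fun n : nat => n%:R^-1 * ln n%:R : R^o))
  (hFnB : bounded_in_prob P
    (fun n w => ereal_sup
      [set `|Fn n t w - F t - n%:R `^ (- 2^-1) * B n (L t) w|%:E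
        | t in `[a, b]])
    gamma)
  (Hn : nat -> T -> R -> R)
  (hHn : forall n w t, t \in `[a, b] ->
    Hn n w t =
      \int[lebesgue_measure]_(x in `[a, t]) (Fn n b w - Fn n x w))
  (Hhat : nat -> T -> R -> R)
  (hHhat : forall n, (0 < n)%N -> forall w,
    is_least_concave_majorant `[a, b] (Hn n w) (Hhat n w)) :
  bounded_in_prob P
    (fun n w => ereal_sup
      [set `|Hhat n w x - Hn n w x|%:E | x in `[a, b]])
    (fun n => ln n%:R / n%:R).
Proof.
have [|c c0 fc] := @pos_inf_lower_bound R `[a, b] f _ hfinf.
  by exists a => /=; rewrite in_itv/= lexx ltW.
have Fc : {in `[a, b] &, forall x y, x <= y -> c * (y - x) <= F y - F x}.
  exact: primitive_increment_ge hF.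
have aI : a \in `[a, b] by rewrite in_itv/= lexx ltW.
have bI : b \in `[a, b] by rewrite in_itv/= lexx ltW.
have Lab : L a <= L b by apply: hLmono => //; exact: ltW.
move=> eps eps0; have eps20 : 0 < eps / 2 by rewrite divr_gt0.
have [K K0 HK] := brownian_oscillation_tight P Lab eps20.
have [M M0 HM] := hFnB _ eps20.
have /eqO_exP[C [C0 HC]] := hgamma.
pose A := (2 * K ^+ 2 + 2 * (M * C) ^+ 2) / (2 * c).
have A0 : 0 <= A.
  apply: divr_ge0; last by rewrite mulr_ge0// ltW.
  by rewrite addr_ge0// mulr_ge0// sqr_ge0.
exists (A + 1); first by lra.
near=> n.
have n0 : (0 < n)%N by near: n; exact: nbhs_infty_gt.
have nR0 : 0 < n%:R :> R by rewrite ltr0n.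
have ln1 : 1 <= ln n%:R :> R.
  rewrite -[leLHS]expRK ler_ln ?posrE ?expR_gt0//.
  by near: n; exact: nbhs_infty_ger.
pose lam : R := ln n%:R / n%:R.
have lam01 : 0 <= lam <= 1.
  rewrite divr_ge0 ?(ltW nR0) ?(le_trans _ ln1)//= ler_pdivrMr// mul1r.
  by rewrite ltW// ln_sublinear.
have gl : `|gamma n| <= C * lam.
  have : `|gamma n| <= C * `|n%:R^-1 * ln n%:R| by near: n.
  rewrite [n%:R^-1 * _]mulrC -/lam [`|lam|]ger0_norm//.
  by case/andP: lam01.
have HMn : (mu_ext P [set w | ((M * gamma n)%:E <
    `|ereal_sup [set `|Fn n t w - F t - n%:R `^ (- 2^-1) * B n (L t) w|%:E | t in `[a, b]]|)%E]
      <= (eps / 2)%:E)%E by near: n.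
set q : R := n%:R `^ (- 2^-1) in HMn.
have q0 : 0 <= q by exact: powR_ge0.
have ql : q ^+ 2 <= lam.
  rewrite powR_Nhalf_sqr ?(ltW nR0)// /lam -[leLHS]mul1r ler_pM2r//.
  by rewrite invr_gt0.
have HKn := HK _ (hB n n0).
(* Half of eps pays for the approximation error, half for the oscillation. *)
rewrite [eps]splitr EFinD; apply: le_trans (leeD HMn HKn).
apply: le_trans (outer_measureU2 _ _ _); apply: le_mu_ext => w /= big.
apply: contrapT => /not_orP[/negP+ /contrapT osc].
rewrite -leNgt => errM; move: big; apply/negP; rewrite -leNgt.
have err t : t \in `[a, b] ->
    `|Fn n t w - F t - q * B n (L t) w| <= M * gamma n.
  move=> tI; rewrite -lee_fin; apply: le_trans errM.
  apply: le_trans (lee_abs _); apply: ereal_sup_ubound.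
  by exists t.
have gap t : t \in `[a, b] -> `|Hhat n w t - Hn n w t| <= A * lam.
  move=> tI; apply: (@le_trans _ _ ((q * K + M * gamma n) ^+ 2 / (2 * c))).
    apply: (@concave_majorant_gap_le _ a b c _ (q * B n (L a) w) F (fun t => Fn n t w)) => //.
    - by have [] := hFn n n0 w.
    - move=> x xI; have LI : L x \in `[L a, L b].
        move: (xI); rewrite !in_itv/= => /andP[ax xb].
        by rewrite !hLmono.
      rewrite (_ : _ - _ - _ = q * (B n (L x) w - B n (L a) w) +
        (Fn n x w - F x - q * B n (L x) w)); last by ring.
      apply: le_trans (ler_normD _ _) _; apply: lerD; last exact: err.
      by rewrite normrM ger0_norm// ler_wpM2l// osc.
    - by move=> x xI; exact: hHn.
    - exact: hHhat.
  rewrite /A [leRHS]mulrAC ler_pM2r ?invr_gt0 ?mulr_gt0//.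
  exact: sqrD_rate_le.
rewrite gee0_abs; last first.
  apply: (@le_trans _ _ (`|Hhat n w a - Hn n w a|%:E)); first by rewrite lee_fin.
  by apply: ereal_sup_ubound; exists a.
apply: ge_ereal_sup => _ [x xI <-]; rewrite lee_fin.
apply: le_trans (gap x xI) _; rewrite ler_wpM2r//; last by lra.
by case/andP: lam01.
Unshelve. all: by end_near.
Qed.
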